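(* Let $d$ be an odd prime, $n\ge1$, and let $\sigma$ be a state on $(\mathbb C^d)^{\otimes n}$ with exact stabilizer skeleton $S_\sigma$, $r=\dim S_\sigma$, and mean state $M(\sigma)$. For $k=r,\ldots,n$ define $$\mathfrak s_k(\sigma)=\min\{S(\Delta_N(\sigma)):\ N\subseteq V^n\text{ isotropic},\ N\supseteq S_\sigma,\ \dim N=k\}.$$ Then $$S(\sigma)=\mathfrak s_r(\sigma)\le\mathfrak s_{r+1}(\sigma)\le\cdots\le\mathfrak s_n(\sigma)\le S(M(\sigma)),$$ and $0\le\mathfrak s_{k+1}(\sigma)-\mathfrak s_k(\sigma)\le\log d$ for every $r\le k<n$.
   Context: All logarithms are base two. $S(\rho)=-\operatorname{tr}\rho\log\rho$ is the von Neumann entropy. Weyl operators. $d$ is an odd prime, $\omega_d=e^{2\pi i/d}$. On one qudit $X|k\rangle=|k+1\rangle$, $Z|k\rangle=\omega_d^k|k\rangle$ (arithmetic mod $d$). $V^n=\mathbb Z_d^n\times\mathbb Z_d^n$; for $p,q\in\mathbb Z_d^n$, $Z^p=\bigotimes_i Z^{p_i}$, $X^q=\bigotimes_i X^{q_i}$, and $w(p,q)=\omega_d^{-2^{-1}p\cdot q}Z^pX^q$ on $(\mathbb C^d)^{\otimes n}$, where $2^{-1}$ is the inverse of $2$ in $\mathbb Z_d$. Symplectic form: $\langle(p,q),(p',q')\rangle_s=p\cdot q'-p'\cdot q$. Characteristic function of a state $\rho$: $\Xi_\rho(z)=\operatorname{tr}[\rho\,w(-z)]$, so $\rho=d^{-n}\sum_{z\in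 V^n}\Xi_\rho(z)w(z)$. A linear subspace $N\subseteq V^n$ is isotropic if $\langle u,v\rangle_s=0$ for all $u,v\in N$. For isotropic $N$ of dimension $k$, the stabilizer pinching is $\Delta_N(\rho)=d^{-k}\sum_{u\in N}w(u)\rho w(u)^\dagger$. The exact stabilizer skeleton of a state $\rho$ is $S_\rho=\{z\in V^n:|\Xi_\rho(z)|=1\}$; it is an isotropic linear subspace. The mean state $M(\rho)$ is the state with $\Xi_{M(\rho)}(z)=\Xi_\rho(z)$ if $z\in S_\rho$ and $\Xi_{M(\rho)}(z)=0$ otherwise. *)

(* Defs.v *)
From mathcomp Require Export all_boot all_order all_algebra.
From mathcomp Require Export complex.
From mathcomp Require Export boolp classical_sets reals exp trigo.

Set Implicit Arguments.
Unset Strict Implicit.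
Unset Printing Implicit Defensive.

Import Order.TTheory GRing.Theory Num.Theory.

Local Open Scope ring_scope.
Local Open Scope sesquilinear_scope.

Section LeastElement.
Variable R : realType.

(* The minimum of a set of reals, as an attained lower bound; a set without
   a least element gets the junk value 0. *)
Definition least (A : set R) : R := xget 0 [set x | A x /\ lbound A x]%classic.

Definition log2 (x : R) : R := ln x / ln 2.

End LeastElement.

Section States.
Variables (R : realType) (m : nat).
Implicit Types A rho : 'M[R[i]]_m.

(* In R[i], 0 <= z means that z is real and nonnegative. *)
Definition psdmx A : Prop :=
  forall v : 'cV[R[i]]_m, 0 <= (v ^t* *m A *m v) 0 0.

Definition density rho : Prop := psdmx rho /\ \tr rho = 1.

(* f(A) through the library's unitary diagonalization
   A = P^-1 diag(spectral_diag A) P; meaningful for Hermitian A. *)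
Definition mxfun (f : R -> R) A : 'M[R[i]]_m :=
  let P := spectralmx A in
  invmx P *m diag_mx (map_mx (fun z => (f (complex.Re z))%:C%C) (spectral_diag A)) *m P.

(* S(rho) = - tr (rho log rho) in bits. Since ln 0 = 0, the null eigenvalues of
   rho contribute 0 log 0 = 0. *)
Definition entropy rho : R := - complex.Re (\tr (rho *m mxfun (@log2 R) rho)).

End States.

(* V^n; for d prime 'F_d is the ring of integers modulo d. *)
Notation phase_space d n := ('rV['F_d]_n * 'rV['F_d]_n)%type.

Section Weyl.
Variables (R : realType) (d n : nat).

Definition omega : R[i] :=
  (cos (2 * pi / d%:R) +i* sin (2 * pi / d%:R))%C.

(* ordS j is j + 1 modulo d. *)
Definition shiftX : 'M[R[i]]_d := \matrix_(i, j) (i == ordS j)%:R.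
Definition clockZ : 'M[R[i]]_d := \matrix_(i, j) (omega ^+ j *+ (i == j)).

(* (C^d)^{\otimes n}, with the product basis |x_1>...|x_n> indexed by the
   functions x : 'I_n -> 'I_d, numbered by enum_val. *)
Definition hdim : nat := #|{: {ffun 'I_n -> 'I_d}}|.
Definition basis (x : 'I_hdim) : {ffun 'I_n -> 'I_d} := enum_val x.

Definition tensmx_n (A : 'I_n -> 'M[R[i]]_d) : 'M[R[i]]_hdim :=
  \matrix_(x, y) \prod_(i < n) A i (basis x i) (basis y i).

Definition dotp (p q : 'rV['F_d]_n) : 'F_d := \sum_(i < n) p 0 i * q 0 i.

Definition sympl (u v : phase_space d n) : 'F_d := dotp u.1 v.2 - dotp v.1 u.2.

(* Elements of 'F_d occurring as exponents are read as their representatives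
   in [0, d). *)
Definition weyl_phase (z : phase_space d n) : 'F_d :=
  - (2%:R^-1) * dotp z.1 z.2.

Definition weyl (z : phase_space d n) : 'M[R[i]]_hdim :=
  omega ^+ weyl_phase z *:
    (tensmx_n (fun i => clockZ ^+ (z.1 0 i)) *m
     tensmx_n (fun i => shiftX ^+ (z.2 0 i))).

Definition charfun (rho : 'M[R[i]]_hdim) (z : phase_space d n) : R[i] :=
  \tr (rho *m weyl (- z)).

Definition isotropic (N : {vspace phase_space d n}) : Prop :=
  {in N &, forall u v, sympl u v = 0}.

Definition pinching (N : {vspace phase_space d n}) (rho : 'M[R[i]]_hdim) :
    'M[R[i]]_hdim :=
  (d%:R ^- \dim N) *: \sum_(u | u \in N) (weyl u *m rho *m (weyl u) ^t*).

Definition skeleton (rho : 'M[R[i]]_hdim) : {set phase_space d n} :=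
  [set z | `|charfun rho z| == 1].

(* The skeleton of a state is a linear subspace, hence equal to its span. *)
Definition dim_skeleton (rho : 'M[R[i]]_hdim) : nat :=
  \dim <<enum (skeleton rho)>>%VS.

(* Definite description: a state is determined by its characteristic function. *)
Definition mean_state (rho : 'M[R[i]]_hdim) : 'M[R[i]]_hdim :=
  xget 0 [set M | density M /\
    forall z, charfun M z = if z \in skeleton rho then charfun rho z else 0]%classic.

Definition min_pinching_entropy (k : nat) (rho : 'M[R[i]]_hdim) : R :=
  least [set s | exists N : {vspace phase_space d n},
    [/\ isotropic N, {subset skeleton rho <= N}, \dim N = k
      & s = entropy (pinching N rho)]]%classic.

End Weyl.

(* Main.v *)
(** The spectrum of a mixture [B = sum_j p_j U_j A U_j^*] of unitary conjugates
    is a doubly stochastic image of the spectrum of [A], so Jensen gives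
    [S(A) <= S(B)].  Conversely [B] is a mixture of pure states with weights
    [p_j l_a], where the [l_a] are the eigenvalues of [A], and these weights are
    a doubly substochastic image of the spectrum of [B], so
    [S(B) <= S(A) + H(p)].

    A pinching by [N] multiplies the characteristic function by the indicator of
    the symplectic complement of [N]; hence pinchings compose by adding
    subspaces, the pinching by the skeleton [S] fixes the state, and the pinching
    by the complement of [S] yields the mean state.  The chain of inequalities
    follows by enlarging [N] one dimension at a time inside an isotropic
    subspace, each step being a mixture of [d] unitary conjugates. *)
Require Import Defs.
From mathcomp Require Import finfield ring lra.
Import Order.TTheory GRing.Theory Num.Theory.
Set Implicit Arguments.
Unset Strict Implicit.
Unset Printing Implicit Defensive.
Local Open Scope ring_scope.
Local Open Scope sesquilinear_scope.

(** * Adjoints and Hermitian matrices *)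

Section Conjugate.
Variable C : numClosedFieldType.

Lemma conjmx_mul m n p (A : 'M[C]_(m, n)) (B : 'M[C]_(n, p)) :
  (A *m B)^t* = B^t* *m A^t*.
Proof. by rewrite trmx_mul map_mxM. Qed.

Lemma conjmxE m n (A : 'M[C]_(m, n)) i j : (A^t*) i j = (A j i)^*.
Proof. by rewrite !mxE. Qed.

Lemma unitarymx_Cmul n (U : 'M[C]_n) : U \is unitarymx -> U^t* *m U = 1%:M.
Proof. by rewrite -trmxC_unitary => /unitarymxP; rewrite trmxCK. Qed.

(** Polarization: the form at [e_i + c e_j] is real, so [c A_ij + c^* A_ji] is real for every [c];
    the choices [c = 1] and [c = 'i] together give [A_ji^* = A_ij]. *)
Lemma nonneg_form_hermitian m (A : 'M[C]_m) :
  (forall v : 'cV[C]_m, 0 <= (v^t* *m A *m v) 0 0) -> A^t* = A.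
Proof.
move=> psdA.
have form i j c : (A i i + c * A i j + c^* * A j i + c^* * c * A j j) \is Num.real.
  suff -> : A i i + c * A i j + c^* * A j i + c^* * c * A j j =
     ((delta_mx i 0 + c *: delta_mx j 0 : 'cV_m)^t* *m A *m
      (delta_mx i 0 + c *: delta_mx j 0 : 'cV_m)) 0 0 by rewrite ger0_real.
  have eE (k l : 'I_m) :
      ((delta_mx k 0 : 'cV[C]_m)^t* *m A *m (delta_mx l 0 : 'cV_m)) 0 0 = A k l.
    by rewrite trmx_delta map_delta_mx -mulmxA -colE -rowE !mxE.
  have -> : (delta_mx i 0 + c *: delta_mx j 0 : 'cV[C]_m)^t* =
     (delta_mx i 0 : 'cV_m)^t* + c^* *: (delta_mx j 0 : 'cV_m)^t*.
    by apply/matrixP=> k l; rewrite !mxE rmorphD rmorphM.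
  have addE (M N : 'M[C]_1) : (M + N) 0 0 = M 0 0 + N 0 0 by rewrite mxE.
  have scaleE a (M : 'M[C]_1) : (a *: M) 0 0 = a * M 0 0 by rewrite mxE.
  rewrite mulmxDl mulmxDl !mulmxDr -!scalemxAr -!scalemxAl.
  rewrite !(addE, scaleE) !eE; ring.
apply/matrixP => i j; rewrite conjmxE.
have real1 c : c * A i j + c^* * A j i \is Num.real.
  have -> : c * A i j + c^* * A j i =
      A i i + c * A i j + c^* * A j i + c^* * c * A j j - A i i - c^* * c * A j j.
    ring.
  have diag k : A k k \is Num.real.
    by have := form k k 0; rewrite conjC0 !mul0r !addr0.
  rewrite !rpredB // rpredM // mulrC -normCK realX // normr_real //.
have /CrealP := real1 1; have /CrealP := real1 'i.
rewrite !(rmorphD, rmorphM, rmorphB, rmorphN, conjCK) /= conjCi.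
rewrite rmorphN /= conjCi opprK conjC1 !mul1r.
rewrite !mulNr conjC1 mul1r => /eqP e1 e2.
have e3 : (A j i)^* - (A i j)^* = A i j - A j i.
  apply: (mulfI (neq0Ci C)); rewrite !mulrBr; apply/eqP; move: e1.
  by rewrite addrC.
have : 2 * (A j i)^* = 2 * A i j.
  transitivity (((A i j)^* + (A j i)^*) + ((A j i)^* - (A i j)^*)); first by ring.
  rewrite e2 e3; ring.
by apply: mulfI; rewrite pnatr_eq0.
Qed.

End Conjugate.

(** * Jensen's inequality for substochastic images *)

Section Jensen.
Variable R : realType.

(* Concavity of [- x ln x] in its tangent-line form [ln (q / mu) <= q / mu - 1]. *)
Lemma jensen_xlnx (I K : finType) (D : K -> I -> R) (mu : I -> R) (q : K -> R) :
  (forall k i, 0 <= D k i) -> (forall i, 0 <= mu i) ->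
  (forall k, q k = \sum_i D k i * mu i) ->
  (forall k, \sum_i D k i <= 1) ->
  (forall i, \sum_k D k i * mu i = mu i) ->
  \sum_k q k * ln (q k) <= \sum_i mu i * ln (mu i).
Proof.
move=> D0 mu0 qE Drow Dcol.
have -> : \sum_i mu i * ln (mu i) = \sum_k \sum_i D k i * mu i * ln (mu i).
  rewrite exchange_big /=; apply: eq_bigr => i _.
  by rewrite -{1}Dcol mulr_suml.
apply: ler_sum => k _.
have q0 : 0 <= q k by rewrite qE sumr_ge0 // => i _; rewrite mulr_ge0.
(* A vanishing [q k] forces every [D k i * mu i] to vanish, so both sides are 0. *)
have [qk0|qkN0] := eqVneq (q k) 0.
  rewrite qk0 mul0r big1 // => i _.
  suff -> : D k i * mu i = 0 by rewrite mul0r.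
  have /eqP := qE k; rewrite qk0 eq_sym psumr_eq0 => [/allP/(_ i)|j _].
    by rewrite mem_index_enum => /(_ isT)/eqP.
  by rewrite mulr_ge0.
have qk : 0 < q k by rewrite lt_def qkN0.
have -> : q k * ln (q k) = \sum_i D k i * mu i * ln (q k).
  by rewrite {1}qE mulr_suml.
rewrite -subr_ge0 -sumrB.
(* The intermediate sum equals [q k * (1 - \sum_i D k i)], nonnegative because the row sums are at
   most 1. *)
apply: (@le_trans _ _ (\sum_i (D k i * mu i - D k i * q k))).
  rewrite sumrB -qE -mulr_suml subr_ge0 ler_piMl //.
apply: ler_sum => i _.
rewrite -mulrBr -!mulrA -!mulrBr ler_wpM2l //.
have := mu0 i; rewrite le_eqVlt => /orP[/eqP<-|mui].
  by rewrite mul0r sub0r oppr_le0.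
have := @le_ln1Dx R (q k / mu i - 1).
rewrite (addrC 1) subrK ltrBrDr addNr divr_gt0 // => /(_ isT).
rewrite ln_div ?posrE // => /(ler_wpM2l (mu0 i)).
rewrite !mulrBr mulr1 mulrCA divff ?gt_eqF // mulr1; lra.
Qed.

End Jensen.

(** * Spectra of positive semidefinite matrices *)

Section Spectrum.
Variables (R : realType) (m : nat).
Implicit Types A B : 'M[R[i]]_m.

Definition eigs A (i : 'I_m) : R := complex.Re (spectral_diag A 0 i).

Lemma psdmx_hermitian A : psdmx A -> A^t* = A.
Proof. exact: nonneg_form_hermitian. Qed.

(** Each diagonal entry is the value of the form at the adjoint of a row of the diagonalizing
    unitary. *)
Lemma spectral_diag_eigs A : psdmx A ->
  A = (spectralmx A)^t* *m diag_mx (spectral_diag A) *m spectralmx A /\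
  forall i, 0 <= eigs A i /\ spectral_diag A 0 i = (eigs A i)%:C%C.
Proof.
move=> psdA.
have /orthomx_spectralP specA : A \is normalmx.
  by apply/normalmxP; rewrite psdmx_hermitian.
have unitP := spectral_unitarymx A.
rewrite (invmx_unitary unitP) in specA.
split=> // i.
suff sp0 : 0 <= spectral_diag A 0 i.
  rewrite /eigs; have /RRe_real -> := ger0_real sp0; split=> //.
  by rewrite -lecR (RRe_real (ger0_real sp0)).
suff -> : spectral_diag A 0 i =
    (((row i (spectralmx A))^t*)^t* *m A *m (row i (spectralmx A))^t*) 0 0.
  exact: psdA.
transitivity ((spectralmx A *m A *m (spectralmx A)^t*) i i).
  rewrite [X in _ *m X *m _]specA !mulmxA (unitarymxP unitP) mul1mx mulmxtVK //.
  by rewrite mxE eqxx.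
rewrite trmxCK -row_mul !mxE; apply: eq_bigr => k _.
by rewrite !mxE.
Qed.

Lemma eigs_ge0 A : psdmx A -> forall i, 0 <= eigs A i.
Proof. by move=> /spectral_diag_eigs[_ eigA] i; have [] := eigA i. Qed.

Lemma spectral_decomposition A : psdmx A ->
  A = (spectralmx A)^t* *m diag_mx (\row_i (eigs A i)%:C%C) *m spectralmx A.
Proof.
move=> /spectral_diag_eigs[specA eigA]; rewrite {1}specA.
congr (_ *m _); congr (_ *m _); congr diag_mx.
by apply/rowP=> i; rewrite mxE; have [] := eigA i.
Qed.

Lemma trace_eigs A : psdmx A -> \tr A = (\sum_i eigs A i)%:C%C.
Proof.
move=> /spectral_decomposition specA; rewrite {1}specA.
rewrite -mulmxA mxtrace_mulC -mulmxA (unitarymxP (spectral_unitarymx A)) mulmx1.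
rewrite mxtrace_diag rmorph_sum; by apply: eq_bigr => i _; rewrite mxE.
Qed.

(** [A] and its logarithm share one diagonalizing unitary, which cancels by cyclicity of the
    trace. *)
Lemma entropyE A : psdmx A -> entropy A = - \sum_i eigs A i * log2 (eigs A i).
Proof.
move=> psdA; rewrite /entropy /mxfun {1}(spectral_decomposition psdA).
have unitP := spectral_unitarymx A.
rewrite (invmx_unitary unitP) !mulmxA.
rewrite (mulmxtVK _ unitP) mxtrace_mulC !mulmxA (unitarymxP unitP) mul1mx.
have -> : map_mx (fun z => (log2 (complex.Re z))%:C%C) (spectral_diag A) =
    \row_i (log2 (eigs A i))%:C%C by apply/rowP=> i; rewrite !mxE.
rewrite mulmx_diag mxtrace_diag.
under eq_bigr do rewrite !mxE -rmorphM.
by rewrite -rmorph_sum.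
Qed.

End Spectrum.

(** * Entropy of a mixture of unitary conjugates *)

Section SquaredModulus.
Variable R : realType.

(** [|z|^2] as an element of [R], so that it can be an entry of a real stochastic matrix. *)
Definition sqmod (z : R[i]) : R := complex.Re z ^+ 2 + complex.Im z ^+ 2.

Lemma sqmodE z : (sqmod z)%:C%C = z * z^*.
Proof. by rewrite /sqmod add_Re2_Im2 normCK. Qed.

Lemma sqmod_ge0 z : 0 <= sqmod z.
Proof. by rewrite addr_ge0 // sqr_ge0. Qed.

Lemma conjC_real (x : R) : (x%:C%C)^* = x%:C%C.
Proof. by apply/CrealP; rewrite complex_real. Qed.

Lemma sum_sqmod_row m (U : 'M[R[i]]_m) i :
  U \is unitarymx -> \sum_j sqmod (U i j) = 1.
Proof.
move=> /unitarymxP/matrixP/(_ i i); rewrite !mxE eqxx => U1.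
apply: complexI; rewrite rmorph_sum rmorph1 -[RHS]U1.
by apply: eq_bigr => j _; rewrite conjmxE; apply: sqmodE.
Qed.

Lemma sum_sqmod_col m (U : 'M[R[i]]_m) j :
  U \is unitarymx -> \sum_i sqmod (U i j) = 1.
Proof.
rewrite -trmx_unitary => /(sum_sqmod_row j) <-.
by apply: eq_bigr => i _; rewrite mxE.
Qed.

End SquaredModulus.

Section UnitaryMixture.
Variables (R : realType) (m : nat) (J : finType).
Variables (A : 'M[R[i]]_m) (p : J -> R) (U : J -> 'M[R[i]]_m).

Definition unitary_mix : 'M[R[i]]_m :=
  \sum_j (p j)%:C%C *: (U j *m A *m (U j)^t*).

Hypothesis psdA : psdmx A.
Hypothesis p_ge0 : forall j, 0 <= p j.

Lemma psdmx_unitary_mix : psdmx unitary_mix.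
Proof.
move=> v; rewrite /unitary_mix mulmx_sumr mulmx_suml summxE.
apply: sumr_ge0 => j _; rewrite -scalemxAr -scalemxAl mxE.
rewrite mulr_ge0 ?ler0c //.
have := psdA ((U j)^t* *m v).
by rewrite conjmx_mul trmxCK !mulmxA.
Qed.

Hypothesis sum_p : \sum_j p j = 1.
Hypothesis unitU : forall j, U j \is unitarymx.

Lemma trace_unitary_mix : \tr unitary_mix = \tr A.
Proof.
rewrite /unitary_mix raddf_sum /= -[RHS]mul1r.
have -> : 1 = \sum_j (p j)%:C%C :> R[i] by rewrite -rmorph_sum sum_p.
rewrite mulr_suml; apply: eq_bigr => j _.
rewrite mxtraceZ mxtrace_mulC mulmxA unitarymx_Cmul ?mul1mx //.
Qed.

Let B := unitary_mix.
(** Column [a] of [G j] holds the coordinates, in the eigenbasis of [B], of the [a]-th eigenvector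
    of [A] moved by [U j]. *)
Let G j := spectralmx B *m U j *m (spectralmx A)^t*.

Let unitG j : G j \is unitarymx.
Proof.
by rewrite !mul_unitarymx ?trmxC_unitary ?spectral_unitarymx.
Qed.

(** [B] written in its own eigenbasis. The off-diagonal identities serve in [weight_le1], where [B]
    is evaluated on a general vector. *)
Let eigs_mix i i' : (eigs B i)%:C%C *+ (i == i') =
  \sum_j \sum_a (p j * eigs A a)%:C%C * (G j i a * (G j i' a)^*).
Proof.
have unitQ := spectral_unitarymx B.
transitivity ((spectralmx B *m B *m (spectralmx B)^t*) i i').
  have specB := spectral_decomposition psdmx_unitary_mix.
  rewrite [X in _ *m X *m _]specB !mulmxA (unitarymxP unitQ) mul1mx mulmxtVK //.
  by rewrite !mxE.
rewrite mulmx_sumr mulmx_suml summxE; apply: eq_bigr => j _.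
rewrite -scalemxAr -scalemxAl mxE.
rewrite [X in U j *m X](spectral_decomposition psdA).
have -> : spectralmx B *m (U j *m ((spectralmx A)^t* *m
      diag_mx (\row_a (eigs A a)%:C%C) *m spectralmx A) *m (U j)^t*) *m
      (spectralmx B)^t* = G j *m diag_mx (\row_a (eigs A a)%:C%C) *m (G j)^t*.
  by rewrite /G !conjmx_mul trmxCK !mulmxA.
rewrite mul_mx_diag mxE mulr_sumr; apply: eq_bigr => a _.
by rewrite !mxE rmorphM /=; ring.
Qed.

Let eigs_mix_diag i :
  eigs B i = \sum_j \sum_a p j * eigs A a * sqmod (G j i a).
Proof.
apply: complexI; have := eigs_mix i i; rewrite eqxx mulr1n => ->.
rewrite rmorph_sum; apply: eq_bigr => j _.
rewrite rmorph_sum; apply: eq_bigr => a _.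
by rewrite [RHS]rmorphM /= sqmodE.
Qed.

Let ln2_gt0 : 0 < ln 2 :> R.
Proof. by rewrite ln_gt0 // ltr1n. Qed.

Let entropy_ln (X : 'M[R[i]]_m) : psdmx X ->
  entropy X = - (\sum_i eigs X i * ln (eigs X i)) / ln 2.
Proof.
move=> psdX; rewrite entropyE // mulNr mulr_suml; congr (- _).
by apply: eq_bigr => i _; rewrite mulrA.
Qed.

Lemma entropy_unitary_mix_ge : entropy A <= entropy unitary_mix.
Proof.
rewrite !entropy_ln //; last exact: psdmx_unitary_mix.
rewrite ler_pM2r ?invr_gt0 // lerN2.
(* This matrix is doubly stochastic, since every [G j] is unitary and the weights sum to 1. *)
apply: (@jensen_xlnx _ _ _ (fun i a => \sum_j p j * sqmod (G j i a))).
- by move=> i a; rewrite sumr_ge0 // => j _; rewrite mulr_ge0 ?sqmod_ge0.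
- exact: eigs_ge0.
- move=> i; rewrite -/B eigs_mix_diag exchange_big; apply: eq_bigr => a _.
  by rewrite mulr_suml; apply: eq_bigr => j _; rewrite mulrAC.
- move=> i; rewrite exchange_big /= -sum_p ler_sum // => j _.
  by rewrite -mulr_sumr sum_sqmod_row ?mulr1.
- move=> a; rewrite -mulr_suml exchange_big /= -[RHS]mul1r -sum_p.
  congr (_ * _); apply: eq_bigr => j _.
  by rewrite -mulr_sumr sum_sqmod_col ?mulr1.
Qed.

(** Put [q = p j * eigs A a] and let [g] be column [a] of [G j]. The term [q g g^*] is dominated by
    [B]; testing this on [v = B^-1 g] gives [q t^2 <= t] for [t = g^* B^-1 g], hence [q t <= 1]. *)
Let weight_le1 j a : p j * eigs A a * (\sum_i sqmod (G j i a) / eigs B i) <= 1.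
Proof.
set q := p j * eigs A a; set t := \sum_i _.
have q_ge0 : 0 <= q by rewrite mulr_ge0 ?eigs_ge0.
have eB i : 0 <= eigs B i by apply/eigs_ge0/psdmx_unitary_mix.
have t_ge0 : 0 <= t by rewrite sumr_ge0 // => i _; rewrite divr_ge0 ?sqmod_ge0.
(* Since the inverse of 0 is 0, [v] is the pseudo-inverse of [B] applied to [g], and null
   eigenvalues drop out of [t]. *)
pose v i := G j i a / (eigs B i)%:C%C.
have vJ i : (v i)^* = (G j i a)^* / (eigs B i)%:C%C.
  by rewrite /v rmorphM /= fmorphV /= conjC_real.
have vBv : t%:C%C = \sum_i \sum_i' (v i)^* * v i' * ((eigs B i)%:C%C *+ (i == i')).
  rewrite rmorph_sum; apply: eq_bigr => i _.
  rewrite (bigD1 i) //= eqxx big1 ?addr0 => [|i' /negPf]; last first.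
    by rewrite eq_sym => ->; rewrite mulr0.
  rewrite vJ /v fmorph_div /= sqmodE.
  have [->|eN0] := eqVneq (eigs B i) 0; first by rewrite rmorph0 invr0 !mulr0.
  rewrite mulr1n; field.
  by rewrite fmorph_eq0.
have vBv2 : t%:C%C = \sum_j' \sum_a' (p j' * eigs A a')%:C%C *
    (sqmod (\sum_i (v i)^* * G j' i a'))%:C%C.
  rewrite vBv.
  under eq_bigr => i _ do under eq_bigr => i' _ do rewrite eigs_mix mulr_sumr.
  under eq_bigr => i _ do rewrite exchange_big.
  rewrite exchange_big; apply: eq_bigr => j' _ /=.
  under eq_bigr => i _ do under eq_bigr => i' _ do rewrite mulr_sumr.
  under eq_bigr => i _ do rewrite exchange_big.
  rewrite exchange_big; apply: eq_bigr => a' _ /=.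
  rewrite sqmodE rmorph_sum mulr_suml mulr_sumr; apply: eq_bigr => i _.
  rewrite !mulr_sumr; apply: eq_bigr => i' _.
  rewrite rmorphM /= conjCK; ring.
have tE : \sum_i (v i)^* * G j i a = t%:C%C.
  rewrite rmorph_sum; apply: eq_bigr => i _.
  by rewrite vJ fmorph_div /= sqmodE; ring.
have qt2 : q * t ^+ 2 <= t.
  have -> : t ^+ 2 = sqmod (\sum_i (v i)^* * G j i a).
    by rewrite tE /sqmod /= expr0n addr0.
  (* Of the nonnegative terms in the expansion of [v^* B v], only the one indexed by [(j, a)] is
     kept. *)
  rewrite -lecR vBv2 [leRHS](bigD1 j) //= [X in _ <= X + _](bigD1 a) //= -addrA rmorphM lerDl.
  apply: addr_ge0; apply: sumr_ge0 => j' _; last apply: sumr_ge0 => a' _.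
    by rewrite -rmorphM ler0c !mulr_ge0 ?sqmod_ge0 ?eigs_ge0.
  by rewrite -rmorphM ler0c !mulr_ge0 ?sqmod_ge0 ?eigs_ge0.
have [->|tN0] := eqVneq t 0; first by rewrite mulr0.
have t_gt0 : 0 < t by rewrite lt_def tN0.
by rewrite -(ler_pM2r t_gt0) mul1r -mulrA -expr2.
Qed.

Lemma entropy_unitary_mix_le : \tr A = 1 ->
  entropy unitary_mix <= entropy A - \sum_j p j * log2 (p j).
Proof.
move=> trA; have sumA : \sum_a eigs A a = 1.
  by apply: complexI; rewrite -trace_eigs.
have -> : \sum_j p j * log2 (p j) = (\sum_j p j * ln (p j)) / ln 2.
  by rewrite mulr_suml; apply: eq_bigr => j _; rewrite mulrA.
rewrite !entropy_ln //; last exact: psdmx_unitary_mix.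
rewrite -mulrBl ler_pM2r ?invr_gt0 // -opprD lerN2.
(* [q] is the product of the distribution [p] and the spectrum of [A], so its entropy is the sum of
   theirs; null weights are split off because [lnM] needs positive arguments. *)
pose q (k : J * 'I_m) := p k.1 * eigs A k.2.
have -> : \sum_i eigs A i * ln (eigs A i) + \sum_j p j * ln (p j) =
    \sum_k q k * ln (q k).
  rewrite -[X in _ = X](pair_bigA _ (fun j a => q (j, a) * ln (q (j, a)))) /=.
  rewrite -[X in X + _]mul1r -[X in _ + X]mulr1 -{1}sum_p -sumA.
  rewrite !mulr_suml -big_split; apply: eq_bigr => j _ /=.
  rewrite !mulr_sumr -big_split; apply: eq_bigr => a _ /=.
  rewrite /q /=; have := p_ge0 j; rewrite le_eqVlt => /orP[/eqP<-|pj].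
    by rewrite !mul0r addr0.
  have := eigs_ge0 psdA a; rewrite le_eqVlt => /orP[/eqP<-|ea].
    by rewrite !(mul0r, mulr0) addr0.
  by rewrite lnM ?posrE //; ring.
have eB i : 0 <= eigs B i by apply/eigs_ge0/psdmx_unitary_mix.
have q_ge0 k : 0 <= q k by rewrite mulr_ge0 ?eigs_ge0.
have eBE i : eigs B i = \sum_k q k * sqmod (G k.1 i k.2).
  rewrite eigs_mix_diag.
  by rewrite (pair_bigA _ (fun j a => p j * eigs A a * sqmod (G j i a))).
(* The transition matrix from the spectrum of [B] to [q]: its rows are substochastic by
   [weight_le1], and [eBE] gives the column condition. *)
apply: (@jensen_xlnx _ _ _
  (fun k i => q k * (sqmod (G k.1 i k.2) / eigs B i))).
- by move=> k i; rewrite mulr_ge0 // divr_ge0 ?sqmod_ge0.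
- exact: eB.
- move=> k; rewrite -[LHS]mulr1 -(sum_sqmod_col k.2 (unitG k.1)) mulr_sumr.
  apply: eq_bigr => i _.
  (* A null eigenvalue of [B] makes every term of its expansion [eBE] vanish, so the division by 0
     is harmless. *)
  have [eB0|eBN0] := eqVneq (eigs B i) 0; last by rewrite -mulrA divfK.
  rewrite eB0 mulr0; have /eqP := eBE i; rewrite eB0 eq_sym psumr_eq0.
    by move/allP/(_ k); rewrite mem_index_enum => /(_ isT)/eqP.
  by move=> k' _; rewrite mulr_ge0 ?sqmod_ge0.
- by move=> k; rewrite -mulr_sumr; apply: weight_le1.
- move=> i; have [->|eBN0] := eqVneq (eigs B i) 0.
    by rewrite big1 // => k _; rewrite mulr0.
  rewrite [RHS]eBE; apply: eq_bigr => k _.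
  by rewrite -mulrA divfK.
Qed.

End UnitaryMixture.

(** * Weyl operators *)

Section DotProduct.
Variables d n : nat.
Implicit Types p q : 'rV['F_d]_n.

Lemma dotpC p q : dotp p q = dotp q p.
Proof. by apply: eq_bigr => i _; rewrite mulrC. Qed.

Lemma dotpDl p p' q : dotp (p + p') q = dotp p q + dotp p' q.
Proof. by rewrite /dotp -big_split; apply: eq_bigr => i _; rewrite mxE mulrDl. Qed.

Lemma dotpDr p q q' : dotp p (q + q') = dotp p q + dotp p q'.
Proof. by rewrite dotpC dotpDl !(dotpC p). Qed.

Lemma dotpNl p q : dotp (- p) q = - dotp p q.
Proof. by rewrite /dotp -sumrN; apply: eq_bigr => i _; rewrite mxE mulNr. Qed.

Lemma dotpNr p q : dotp p (- q) = - dotp p q.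
Proof. by rewrite dotpC dotpNl dotpC. Qed.

Lemma dotp0l q : dotp 0 q = 0.
Proof. by rewrite /dotp big1 // => i _; rewrite mxE mul0r. Qed.

Lemma dotp0r p : dotp p 0 = 0.
Proof. by rewrite dotpC dotp0l. Qed.

Lemma dotp_delta p i : dotp p (delta_mx 0 i) = p 0 i.
Proof.
rewrite /dotp (bigD1 i) //= mxE !eqxx mulr1 big1 ?addr0 // => j jNi.
by rewrite mxE (negPf jNi) andbF mulr0.
Qed.

Implicit Types u v w : phase_space d n.

Lemma symplC u v : sympl u v = - sympl v u.
Proof. by rewrite /sympl opprB. Qed.

Lemma symplDl u v w : sympl (u + v) w = sympl u w + sympl v w.
Proof. by rewrite /sympl /= dotpDl dotpDr; ring. Qed.

Lemma symplDr u v w : sympl u (v + w) = sympl u v + sympl u w.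
Proof. by rewrite symplC symplDl opprD -!symplC. Qed.

Lemma sympl0l u : sympl 0 u = 0.
Proof. by rewrite /sympl /= dotp0l dotp0r subrr. Qed.

Lemma symplNr u v : sympl u (- v) = - sympl u v.
Proof. by rewrite /sympl /= dotpNl dotpNr; ring. Qed.

Lemma symplNl u v : sympl (- u) v = - sympl u v.
Proof. by rewrite symplC symplNr -symplC. Qed.

Lemma symplxx u : sympl u u = 0.
Proof. by rewrite /sympl subrr. Qed.

(** Pairing with coordinate vectors reads off the entries of both components of [u]. *)
Lemma sympl_nondegenerate u : (forall v, sympl u v = 0) -> u = 0.
Proof.
case: u => p q pq0; congr (_, _); apply/rowP => i; rewrite mxE.
  have := pq0 (0, delta_mx 0 i).
  by rewrite /sympl /= dotp0l subr0 dotp_delta.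
have := pq0 (delta_mx 0 i, 0).
by rewrite /sympl /= dotp0r sub0r dotpC dotp_delta => /eqP; rewrite oppr_eq0 => /eqP.
Qed.

End DotProduct.

(** * The additive character of the prime field *)

Section AdditiveCharacter.
Variables (R : realType) (d : nat).
Local Notation omega := (omega R d).

(** The exponent is the representative of [a] below [d], so additivity of [chi] rests on
    [omega ^+ d = 1]. *)
Definition chi (a : 'F_d) : R[i] := omega ^+ a.

Lemma omegaX k :
  omega ^+ k = (cos (2 * pi / d%:R * k%:R) +i* sin (2 * pi / d%:R * k%:R))%C.
Proof.
elim: k => [|k IHk]; first by rewrite expr0 mulr0 cos0 sin0.
have -> : 2 * pi / d%:R * k.+1%:R = 2 * pi / d%:R * k%:R + 2 * pi / d%:R :> R.
  by rewrite mulrSr; ring.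
rewrite exprSr IHk cosD sinD.
by apply/eqP; rewrite eq_complex /=; apply/andP; split; apply/eqP; ring.
Qed.

Lemma omega_conj : omega * omega^* = 1.
Proof. by rewrite -sqmodE /sqmod /= cos2Dsin2. Qed.

Hypothesis prime_d : prime d.

Lemma omega_order : omega ^+ d = 1.
Proof.
rewrite omegaX divfK ?pnatr_eq0 -?lt0n ?prime_gt0 //.
by rewrite mulr_natl cos2pi sin2pi.
Qed.

(** The real part of [omega] is [1 - 2 sin(pi/d)^2], and [pi/d] lies strictly between 0 and [pi]. *)
Lemma omega_neq1 : omega != 1.
Proof.
have d_gt1 := prime_gt1 prime_d.
have d_gt0 : 0 < d%:R :> R by rewrite ltr0n prime_gt0.
apply/eqP => /(congr1 (@complex.Re R)) /=.
have -> : 2 * pi / d%:R = (pi / d%:R) *+ 2 :> R by rewrite -mulr_natl; ring.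
rewrite cos_mulr2n cos2sin2.
have : 0 < sin (pi / d%:R) :> R.
  rewrite sin_gt0_pi // divr_gt0 ?pi_gt0 //=.
  by rewrite ltr_pdivrMr // ltr_pMr ?pi_gt0 // ltr1n.
move=> /(exprn_gt0 2); rewrite -mulr_natl; lra.
Qed.

Lemma chi_nat k : chi k%:R = omega ^+ k.
Proof. by rewrite /chi val_Fp_nat // expr_mod ?omega_order. Qed.

Lemma natr_Fp (a : 'F_d) : (a : nat)%:R = a.
Proof.
apply: val_inj; rewrite /= val_Fp_nat // modn_small //.
by rewrite -[X in (_ < X)%N](Fp_cast prime_d).
Qed.

Lemma chiD a b : chi (a + b) = chi a * chi b.
Proof. by rewrite -(natr_Fp a) -(natr_Fp b) -natrD !chi_nat exprD. Qed.

Lemma chi0 : chi 0 = 1.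
Proof. by rewrite -[0]/(0%:R) chi_nat expr0. Qed.

Lemma chiVN a : chi a * chi (- a) = 1.
Proof. by rewrite -chiD subrr chi0. Qed.

Lemma chi_mul_conj a : chi a * (chi a)^* = 1.
Proof. by rewrite /chi rmorphXn -exprMn omega_conj expr1n. Qed.

Lemma chi_neq0 a : chi a != 0.
Proof. by apply/eqP => c0; have /eqP := chiVN a; rewrite c0 mul0r eq_sym oner_eq0. Qed.

Lemma conj_chi a : (chi a)^* = chi (- a).
Proof. by apply: (mulfI (chi_neq0 a)); rewrite chi_mul_conj chiVN. Qed.

Lemma norm_chi a : `|chi a| = 1.
Proof.
apply/eqP; rewrite -(@eqrXn2 _ 2) ?normr_ge0 ?ler01 //.
by rewrite normCK chi_mul_conj expr1n.
Qed.

Lemma chi_eq1 a : (chi a == 1) = (a == 0).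
Proof.
apply/eqP/eqP => [chi1|->]; last exact: chi0.
apply/eqP; apply: contraTT omega_neq1 => aN0; apply/negPn/eqP.
(* [1 = a * a^-1] is an integer multiple of [a], so [chi a = 1] would give [omega = chi 1 = 1]. *)
rewrite -[LHS]expr1 -[LHS]chi_nat -(divff aN0) -(natr_Fp (a^-1)).
rewrite mulr_natr.
have chi_mulrn k : chi (a *+ k) = 1.
  elim: k => [|k IHk]; first by rewrite mulr0n chi0.
  by rewrite mulrS chiD IHk chi1 mulr1.
exact: chi_mulrn.
Qed.

(** Reindexing along [t] multiplies the sum by [chi c], which differs from 1. The abstract [T], [S]
    and [t] cover translations of row vectors, of a subspace and of the whole phase space. *)
Lemma sum_chi_eq0 (T : finType) (S : pred T) (f : T -> 'F_d) (t : T -> T) c :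
  injective t -> (forall a, S (t a) = S a) -> (forall a, f (t a) = c + f a) ->
  c != 0 -> \sum_(u | S u) chi (f u) = 0.
Proof.
move=> t_inj tS tf cN0.
have sumE : \sum_(u | S u) chi (f u) = chi c * \sum_(u | S u) chi (f u).
  rewrite {1}(reindex_inj t_inj) mulr_sumr /=.
  by apply: eq_big => [u|u _]; [exact: tS | rewrite tf chiD].
apply/eqP; have : (1 - chi c) * (\sum_(u | S u) chi (f u)) == 0.
  by rewrite mulrBl mul1r -sumE subrr.
by rewrite mulf_eq0 subr_eq0 eq_sym chi_eq1 // (negPf cN0).
Qed.

End AdditiveCharacter.

(** * Matrix entries and relations of the Weyl operators *)

Section WeylAlgebra.
Variables (R : realType) (d n : nat).
Hypothesis prime_d : prime d.
Local Notation W := (@weyl R d n).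
Local Notation chi := (@chi R d).
Implicit Types (x y : 'I_(hdim d n)) (u v z : phase_space d n).

(** Identifies the product basis with vectors over ['F_d], which turns powers of the shift into
    translations. *)
Definition position x : 'rV['F_d]_n := \row_i (basis x i : nat)%:R.

Lemma ltn_Fp (a : 'F_d) : (a < d)%N.
Proof. by rewrite -[X in (_ < X)%N](Fp_cast prime_d). Qed.

Lemma natr_Fp_inj (i j : 'I_d) : ((i : nat)%:R == (j : nat)%:R :> 'F_d) = (i == j).
Proof.
apply/eqP/eqP => [/(congr1 val)|->//]; rewrite /= !val_Fp_nat //.
by rewrite !modn_small // => /val_inj.
Qed.

Lemma natr_mod_Fp k : (k %% d)%:R = k%:R :> 'F_d.
Proof. by apply: val_inj; rewrite /= !val_Fp_nat // modn_mod. Qed.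

Definition position_inv (v : 'rV['F_d]_n) : 'I_(hdim d n) :=
  enum_rank [ffun i => Ordinal (ltn_Fp (v 0 i))].

Lemma positionK : cancel position position_inv.
Proof.
move=> x; apply: enum_val_inj; rewrite enum_rankK; apply/ffunP => i.
rewrite ffunE; apply/eqP; rewrite -natr_Fp_inj /= natr_Fp //.
by rewrite mxE.
Qed.

Lemma position_invK : cancel position_inv position.
Proof.
by move=> v; apply/rowP => i; rewrite mxE /basis enum_rankK ffunE /= natr_Fp.
Qed.

Lemma position_inj : injective position.
Proof. exact: can_inj positionK. Qed.

Lemma clockZX k i j : (clockZ R d ^+ k) i j = omega R d ^+ (i * k) *+ (i == j).
Proof.
elim: k j => [|k IHk] j; first by rewrite expr0 muln0 expr0 mxE.
rewrite exprSr mxE (bigD1 i) //= big1 => [|l lNi].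
  rewrite IHk eqxx mulr1n mxE mulrnAr -exprD mulnSr addr0.
  by case: eqP => [<-|].
by rewrite IHk eq_sym (negPf lNi) mul0r.
Qed.

Lemma shiftXX k i j : (shiftX R d ^+ k) i j =
  ((i : nat)%:R == (j : nat)%:R + k%:R :> 'F_d)%:R.
Proof.
elim: k j => [|k IHk] j; first by rewrite expr0 addr0 natr_Fp_inj mxE.
rewrite exprSr mxE (bigD1 (ordS j)) //= big1 ?addr0 => [|l lNj].
  rewrite IHk mxE eqxx mulr1 /= natr_mod_Fp.
  by rewrite -(addn1 j) -(addn1 k) !natrD addrAC addrA.
by rewrite mxE (negPf lNj) mulr0.
Qed.

(** [X^q] moves position [y] to [y + q], and [Z^p] then contributes the phase at the new position.
    The Weyl relations below are read off from this formula. *)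
Lemma weylE z x y : W z x y =
  chi (weyl_phase z + dotp z.1 (position x)) *+ (position x == position y + z.2).
Proof.
rewrite /weyl mxE chiD // -mulrnAr; congr (_ * _).
rewrite mxE (bigD1 x) //= big1 ?addr0 => [|k kNx]; last first.
  rewrite mxE.
  have [i /negPf xki] : exists i, basis x i != basis k i.
    apply/existsP; rewrite -negb_forall; apply: contra kNx => /forallP xk.
    by apply/eqP/enum_val_inj/ffunP => i; rewrite -(eqP (xk i)).
  by rewrite (bigD1 i) //= clockZX xki !mul0r.
rewrite !mxE; under eq_bigr do rewrite clockZX eqxx mulr1n.
under [X in _ * X]eq_bigr do rewrite shiftXX.
rewrite -mulr_natr; congr (_ * _).
  rewrite -[RHS]/(chi _) /dotp.
  elim/big_ind2 : _ => [|a a' b b' -> ->|i _]; rewrite ?chi0 ?chiD //.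
  by rewrite mxE mulnC exprM -exprM -chi_nat // natrM natr_Fp.
have [xyz|xyNz] := eqVneq (position x) (position y + z.2).
  rewrite big1 // => i _; have /rowP/(_ i) := xyz.
  by rewrite !mxE natr_Fp // => ->; rewrite eqxx.
apply/eqP; rewrite prodf_seq_eq0; apply/hasP.
have /existsP[i xyNi] : [exists i, position x 0 i != (position y + z.2) 0 i].
  rewrite -negb_forall; apply: contra xyNz => /forallP xyz.
  by apply/eqP/rowP => i; apply/eqP.
exists i; rewrite ?mem_index_enum //= pnatr_eq0 eqb0.
by move: xyNi; rewrite !mxE natr_Fp.
Qed.

Hypothesis odd_d : odd d.

(** Oddness of [d] makes the factor [2%:R^-1] of the Weyl phase a genuine inverse. *)
Lemma Fp2_neq0 : 2%:R != 0 :> 'F_d.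
Proof.
rewrite -(dvdn_pcharf (pchar_Fp prime_d)) dvdn_prime2 //.
by apply: contraTneq odd_d => ->.
Qed.

(** The half in [weyl_phase] antisymmetrizes the cross terms and leaves half the symplectic form;
    hence [W u] and [W (- u)] are inverse to each other without any phase. *)
Lemma weyl_mul u v : W u *m W v = chi (2%:R^-1 * sympl u v) *: W (u + v).
Proof.
apply/matrixP => x y; rewrite [in RHS]mxE !weylE.
rewrite mxE (bigD1 (position_inv (position y + v.2))) //= big1 ?addr0 => [|k kNy].
  have -> : position y + (u + v).2 = position y + v.2 + u.2.
    by rewrite /= -addrA (addrC u.2).
  rewrite !weylE position_invK eqxx mulr1n.
  case: eqP => [->|_]; last by rewrite !(mulr0n, mul0r, mulr0).
  rewrite !mulr1n -!chiD //; congr chi.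
  rewrite /weyl_phase /sympl /= !(dotpDl, dotpDr).
  by field; exact: Fp2_neq0.
rewrite (weylE v).
case: eqP => [kE|_]; last by rewrite mulr0n mulr0.
by rewrite -kE positionK eqxx in kNy.
Qed.


Lemma weyl0 : W 0 = 1%:M.
Proof.
apply/matrixP => x y; rewrite weylE mxE /= addr0 (inj_eq position_inj).
by rewrite /weyl_phase /= !dotp0l mulr0 addr0 chi0.
Qed.

Lemma weyl_adj u : (W u)^t* = W (- u).
Proof.
apply/matrixP => x y; rewrite conjmxE !weylE rmorphMn /= conj_chi //.
have -> : (position x == position y + (- u).2) = (position y == position x + u.2).
  by rewrite eq_sym /= subr_eq.
case: eqP => // ->.
rewrite !mulr1n; congr chi; rewrite /weyl_phase /= !(dotpNl, dotpNr, dotpDr).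
by field; exact: Fp2_neq0.
Qed.

Lemma weyl_unitary u : W u \is unitarymx.
Proof.
apply/unitarymxP; rewrite weyl_adj weyl_mul subrr symplNr symplxx oppr0 mulr0.
by rewrite chi0 // scale1r weyl0.
Qed.

Lemma weylNK u : W u *m W (- u) = 1%:M.
Proof. by rewrite -weyl_adj; apply/unitarymxP/weyl_unitary. Qed.

Lemma weyl_comm u v : W u *m W v = chi (sympl u v) *: (W v *m W u).
Proof.
rewrite !weyl_mul (addrC v) (symplC v u) scalerA -chiD //.
by congr (chi _ *: _); field; exact: Fp2_neq0.
Qed.

(* Fourier inversion in the [p]-coordinate isolates the matrix units:
   sum_p chi(- p . b) Z^p X^q = d^n |b><b - q|. *)
Lemma charfun_inj (A B : 'M[R[i]]_(hdim d n)) : charfun A =1 charfun B -> A = B.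
Proof.
move=> AB; suff AB0 (D : 'M[R[i]]_(hdim d n)) : charfun D =1 (fun=> 0) -> D = 0.
  apply/eqP; rewrite -subr_eq0; apply/eqP/AB0 => z.
  by rewrite /charfun mulmxBl raddfB /= -!/(charfun _ _) AB subrr.
move=> D0; apply/matrixP => y x; rewrite [RHS]mxE.
(* [q] is chosen so that the entry [(x, y)] lies in the support of [W (p, q)], and [c p] cancels the
   phase in row [x]. *)
pose q := position x - position y.
pose c (p : 'rV['F_d]_n) := chi (- (weyl_phase (p, q) + dotp p (position x))).
have sumE : \sum_p c p *: W (p, q) = #|{: 'rV['F_d]_n}|%:R *: delta_mx x y.
  apply/matrixP => x' y'; rewrite summxE !mxE.
  under eq_bigr do rewrite mxE weylE mulrnAr -chiD //.
  have [x'y'|x'Ny'] := eqVneq (position x') (position y' + q); last first.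
    rewrite big1 //.
    apply/esym/eqP; rewrite mulf_eq0; apply/orP; right.
    rewrite pnatr_eq0 eqb0; apply: contra x'Ny' => /andP[/eqP-> /eqP->].
    by rewrite addrC subrK.
  have [x'x|x'Nx] := eqVneq x' x; last first.
    rewrite mulr0.
    have [i xi] : exists i, (position x' - position x) 0 i != 0.
      apply/existsP; rewrite -negb_forall; apply: contra x'Nx => /forallP xx'.
      rewrite -(inj_eq position_inj) -subr_eq0; apply/eqP/rowP => i.
      by rewrite (eqP (xx' i)) mxE.
    (* In any other row [x'] the remaining phases form a nontrivial character of [p], whose sum is
       0. *)
    have sum0 : \sum_(p | predT p) chi (dotp p (position x' - position x)) = 0.
      apply: (sum_chi_eq0 R prime_d (addrI (delta_mx 0 i))) xi => // p.
      by rewrite dotpDl (dotpC (delta_mx 0 i)) dotp_delta.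
    rewrite -[RHS]sum0.
    apply: eq_bigr => p _; rewrite mulr1n dotpDr dotpNr; congr chi; ring.
  have -> : y' = y.
    by apply/position_inj/(addIr q); rewrite -x'y' x'x /q addrC subrK.
  rewrite x'x eqxx mulr1 -sumr_const; apply: eq_bigr => p _.
  by rewrite mulr1n -(chi0 R prime_d); congr chi; ring.
have : \sum_p c p * \tr (D *m W (p, q)) = 0.
  rewrite big1 // => p _; have := D0 (- (p, q)).
  by rewrite /charfun opprK => ->; rewrite mulr0.
under eq_bigr do rewrite -mxtraceZ scalemxAr.
rewrite -raddf_sum -mulmx_sumr sumE -scalemxAr /= mxtraceZ => /eqP.
rewrite mulf_eq0 pnatr_eq0; case/orP => [/eqP card0|/eqP].
  by have := @fintype0 _ (0 : 'rV['F_d]_n) card0.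
rewrite -(mul_delta_mx (0 : 'I_1)) mulmxA mxtrace_mulC -colE -rowE trace_mx11.
by rewrite !mxE.
Qed.

End WeylAlgebra.

(** * Unitaries with expectation value of modulus one *)

Lemma subrACA (T : zmodType) (a b c e : T) : a - b - (c - e) = a - c - (b - e).
Proof. by rewrite !opprB addrACA [RHS]addrACA (addrC (- b)). Qed.

Section RigidTrace.
Variables (R : realType) (m : nat).

Lemma psdmx_gram (A : 'M[R[i]]_m) : psdmx A -> exists K : 'M[R[i]]_m, A = K^t* *m K.
Proof.
move=> psdA; pose D : 'M[R[i]]_m := diag_mx (\row_i (Num.sqrt (eigs A i))%:C%C).
exists (D *m spectralmx A); rewrite {1}(spectral_decomposition psdA).
rewrite conjmx_mul !mulmxA; congr (_ *m _); rewrite -mulmxA; congr (_ *m _).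
have -> : D^t* = D.
  apply/matrixP => i j; rewrite conjmxE !mxE rmorphMn /= conjC_real eq_sym.
  by case: eqP => // ->.
rewrite mulmx_diag; congr diag_mx; apply/rowP => i.
by rewrite !mxE -rmorphM /= -expr2 sqr_sqrtr ?eigs_ge0.
Qed.

(** The trace is the sum of the squared moduli of the entries of [X]. *)
Lemma gram_trace_eq0 (X : 'M[R[i]]_m) : \tr (X *m X^t*) = 0 -> X = 0.
Proof.
have sum_ge0 i : 0 <= \sum_j `|X i j| ^+ 2 by apply: sumr_ge0 => j _; rewrite exprn_ge0.
have -> : \tr (X *m X^t*) = \sum_i \sum_j `|X i j| ^+ 2.
  apply: eq_bigr => i _; rewrite mxE; apply: eq_bigr => j _.
  by rewrite conjmxE normCK.
move=> /eqP; rewrite psumr_eq0 => [/allP X0|i _]; last exact: sum_ge0.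
apply/matrixP => i j; have := X0 i; rewrite mem_index_enum => /(_ isT).
rewrite psumr_eq0 => [/allP/(_ j)|k _]; last by rewrite exprn_ge0.
by rewrite mem_index_enum => /(_ isT); rewrite sqrf_eq0 normr_eq0 mxE => /eqP.
Qed.

(* Equality case of Cauchy-Schwarz: with [A = K^* K], the squared
   Hilbert-Schmidt norm of [(U - tr(A U)) K^*] is [1 - |tr(A U)|^2]. *)
Lemma unitary_eigen (A U : 'M[R[i]]_m) : density A -> U \is unitarymx ->
  `|\tr (A *m U)| = 1 -> U *m A = \tr (A *m U) *: A.
Proof.
move=> [psdA trA] unitU; set c := \tr _ => c1.
have [K AE] := psdmx_gram psdA.
apply/eqP; rewrite -subr_eq0 -mul_scalar_mx -mulmxBl AE mulmxA.
suff -> : (U - c%:M) *m K^t* = 0 by rewrite mul0mx.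
apply: gram_trace_eq0.
rewrite conjmx_mul trmxCK mulmxA -(mulmxA _ (K^t*)) -AE.
have -> : (U - c%:M)^t* = U^t* - (c^*)%:M.
  apply/matrixP => i j; rewrite !mxE rmorphB rmorphMn /= eq_sym.
  by [].
have -> : (U - c%:M) *m A *m (U^t* - (c^*)%:M) =
    U *m A *m U^t* - c^* *: (U *m A) - (c *: (A *m U^t*) - (c^* * c) *: A).
  rewrite mulmxBr !mulmxBl !mul_mx_scalar !mul_scalar_mx -scalemxAl -scalerA.
  exact: subrACA.
(* The first of the four traces is 1 and the others are [|c|^2]; with their signs they add up to
   [1 - |c|^2 = 0]. *)
rewrite !raddfB /= !mxtraceZ trA.
have -> : \tr (U *m A *m U^t*) = 1.
  by rewrite mxtrace_mulC mulmxA unitarymx_Cmul // mul1mx.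
have -> : \tr (A *m U^t*) = c^*.
  rewrite -{1}(psdmx_hermitian psdA) -conjmx_mul /c mxtrace_mulC.
  by rewrite /mxtrace rmorph_sum; apply: eq_bigr => i _; rewrite conjmxE.
have -> : \tr (U *m A) = c by rewrite mxtrace_mulC.
by rewrite mulr1 (mulrC c) -normCKC c1 expr1n !subrr addr0.
Qed.
End RigidTrace.

(** * Symplectic complements *)

Section Symplectic.
Variables (d n : nat).
Hypothesis prime_d : prime d.
Local Notation V := (phase_space d n).
Implicit Types (u v z : V) (N S : {vspace V}).

Lemma card_subspace N : #|N| = (d ^ \dim N)%N.
Proof. by rewrite card_vspace card_Fp. Qed.

(** Over a prime field a scalar multiple is a repeated sum, so additive closure gives linear
    closure. *)
Lemma mem_span_closed (E : {set V}) : 0 \in E -> {in E &, forall u v, u + v \in E} ->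
  forall u, (u \in <<enum E>>%VS) = (u \in E).
Proof.
move=> E0 ED u; apply/idP/idP => [uE|uE]; last by rewrite memv_span ?mem_enum.
have EZ a v : v \in E -> a *: v \in E.
  move=> vE; rewrite -(natr_Fp prime_d a) scaler_nat.
  by elim: (nat_of_ord a) => [|k IHk]; rewrite ?mulr0n // mulrS ED.
rewrite (coord_span uE); elim/big_ind: _ => //.
move=> i _; apply: EZ; rewrite -mem_enum; apply: mem_nth.
  by rewrite size_tuple.
Qed.

(** The symplectic complement, written as a span to be of subspace type; [perpP] shows that spanning
    adds nothing. *)
Definition perp N : {vspace V} :=
  <<enum [set z : V | [forall u : V, (u \in N) ==> (sympl u z == 0)%R]]>>%VS.

Lemma perpP N z : reflect {in N, forall u, sympl u z = 0} (z \in perp N).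
Proof.
rewrite mem_span_closed; last first.
- move=> v w; rewrite !inE => /forallP v0 /forallP w0; apply/forallP => u.
  apply/implyP => uN; rewrite symplDr.
  by rewrite (eqP (implyP (v0 u) uN)) (eqP (implyP (w0 u) uN)) addr0.
- rewrite inE; apply/forallP => u; apply/implyP => _.
  by rewrite symplC sympl0l oppr0.
rewrite inE; apply: (iffP forallP) => zN u; first by move=> uN; apply/eqP/(implyP (zN u)).
by apply/implyP => uN; rewrite zN.
Qed.

Lemma perpS N N' : (N <= N')%VS -> (perp N' <= perp N)%VS.
Proof.
by move=> /subvP NN'; apply/subvP => z /perpP zN'; apply/perpP => u /NN'/zN'.
Qed.

Lemma isotropicE N : isotropic N <-> (N <= perp N)%VS.
Proof.
split=> [isoN|/subvP Nperp u v uN vN]; last exact: (perpP N v (Nperp v vN)).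
by apply/subvP => v vN; apply/perpP => u uN; apply: isoN.
Qed.

End Symplectic.

(** * Orthogonality of characters on a subspace *)

Section CharacterSums.
Variables (R : realType) (d n : nat).
Hypothesis prime_d : prime d.
Local Notation V := (phase_space d n).
Local Notation chi := (@chi R d).
Implicit Types (u v z : V) (N S : {vspace V}).

(** On the complement every term is 1; elsewhere, translation by some [u] in [N] with
    [sympl u z != 0] makes the sum vanish. *)
Lemma sum_chi_subspace N z :
  \sum_(u | u \in N) chi (sympl u z) = (d ^ \dim N)%:R *+ (z \in perp N).
Proof.
case: (perpP prime_d) => [zN|zNN].
  under eq_bigr => u uN do rewrite zN // chi0 //.
  by rewrite sumr_const -card_subspace.
have [u uN uz] : exists2 u, u \in N & sympl u z != 0.
  apply/exists_inP; apply: contra_notT zNN.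
  rewrite negb_exists_in => /forall_inP zN u uN.
  by apply/eqP; rewrite -[_ == _]negbK zN.
apply: (sum_chi_eq0 R prime_d (addrI u)) uz => v; first by rewrite rpredDl.
exact: symplDl.
Qed.

End CharacterSums.

(** * Dimensions of complements and extension of isotropic subspaces *)

Section SymplecticDimension.
Variables (R : realType) (d n : nat).
Hypothesis prime_d : prime d.
Local Notation V := (phase_space d n).
Implicit Types (u v z : V) (N S : {vspace V}).

Lemma card_phase_space : #|{: V}| = (d ^ (n + n))%N.
Proof. by rewrite card_prod !card_mx card_Fp // mul1n expnD. Qed.

(* Summing [chi <u, z>] over u in N and all z gives |N| |perp N| when u is summed
   first and |V| when z is, by nondegeneracy.  [R] only hosts the characters. *)
Lemma dim_perp N : (\dim N + \dim (perp N))%N = (n + n)%N.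
Proof.
have chisum : \sum_(z : V) \sum_(u | u \in N) chi R (sympl u z) = (d ^ (n + n))%:R.
  rewrite exchange_big /= (bigD1 (0 : V)) ?mem0v //=.
  rewrite [X in _ + X]big1 ?addr0 => [|u /andP[uN uN0]].
    under eq_bigr do rewrite sympl0l chi0 //.
    by rewrite sumr_const card_phase_space.
  have [z uz] : exists z, sympl u z != 0.
    apply/existsP; apply: contraNT uN0; rewrite negb_exists => /forallP u0.
    apply/eqP/sympl_nondegenerate => z; apply/eqP.
    by rewrite -[_ == _]negbK u0.
  by apply: (sum_chi_eq0 R prime_d (addrI z)) uz => // v; apply: symplDr.
apply/eqP; rewrite -(eqn_exp2l _ _ (prime_gt1 prime_d)) expnD.
rewrite -(eqr_nat R[i]) -chisum natrM.
under eq_bigr do rewrite sum_chi_subspace // mulrb.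
by rewrite -big_mkcond sumr_const card_subspace // mulr_natr.
Qed.

(** [N] lies in its double complement, and two uses of [dim_perp] equate the dimensions. *)
Lemma perpK N : perp (perp N) = N.
Proof.
apply/eqP; rewrite eq_sym eqEdim; apply/andP; split.
  apply/subvP => u uN; apply/(perpP prime_d) => v /(perpP prime_d) vN.
  by rewrite symplC vN ?oppr0.
by rewrite -(leq_add2l (\dim (perp N))) dim_perp addnC dim_perp.
Qed.

(** [N] lies in [perp N], and the two dimensions add up to [n + n]. *)
Lemma isotropic_dim N : isotropic N -> (\dim N <= n)%N.
Proof.
move=> /(isotropicE prime_d)/dimvS dimN.
by rewrite -leq_double -!addnn -(dim_perp N) leq_add2l.
Qed.

Lemma dim_add_line N v : v \notin N -> \dim (N + <[v]>)%VS = (\dim N).+1.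
Proof.
move=> vN; rewrite dimv_disjoint_sum.
  by rewrite dim_vline; case: eqVneq vN => [->|]; rewrite ?mem0v ?addn1.
apply/eqP; rewrite -subv0; apply/subvP => w.
rewrite memv_cap => /andP[wN /vlineP[a wE]]; rewrite memv0 wE.
have [->|aN0] := eqVneq a 0; first by rewrite scale0r.
case/negP: vN; rewrite -[v]scale1r -(mulVf aN0) -scalerA -wE.
by rewrite rpredZ.
Qed.

(** Below dimension [n] the complement has larger dimension than [N]. Any [v] in [perp N] outside
    [N] works, as it pairs to 0 with [N] and with itself. *)
Lemma isotropic_extend N : isotropic N -> (\dim N < n)%N -> exists v,
  isotropic (N + <[v]>)%VS /\ \dim (N + <[v]>)%VS = (\dim N).+1.
Proof.
move=> isoN dimN.
have [v vperp vN] : exists2 v, v \in perp N & v \notin N.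
  apply/subvPn; apply: contraL dimN => /dimvS; rewrite -leqNgt => dimN.
  by rewrite -leq_double -!addnn -(dim_perp N) leq_add2l.
exists v; split; last exact: dim_add_line.
move=> x y /memv_addP[u uN [w /vlineP[a ->] ->]].
move=> /memv_addP[u' u'N [w' /vlineP[b ->] ->]].
have symplZ c t : sympl t v = 0 -> sympl t (c *: v) = 0.
  move=> tv; rewrite -(natr_Fp prime_d c) scaler_nat.
  elim: (nat_of_ord c) => [|k IHk]; first by rewrite mulr0n symplC sympl0l oppr0.
  by rewrite mulrS symplDr tv IHk addr0.
have vv c : sympl v (c *: v) = 0 by rewrite symplZ // symplxx.
have vN0 t : t \in N -> sympl t v = 0 by apply/(perpP prime_d).
rewrite symplDl !symplDr isoN // (symplZ b u) ?vN0 //.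
rewrite [sympl (a *: v) u']symplC (symplZ a u') ?vN0 //.
rewrite (symplZ b (a *: v)) ?[sympl (a *: v) v]symplC ?vv //.
by rewrite oppr0 !addr0.
by rewrite oppr0.
Qed.

Lemma intermediate_subspace S N k : (S <= N)%VS -> (\dim S <= k <= \dim N)%N ->
  exists N', [/\ (S <= N')%VS, (N' <= N)%VS & \dim N' = k].
Proof.
move=> SN /andP[]; elim: k => [|k IHk].
  by rewrite leqn0 => /eqP dimS _; exists S.
rewrite leq_eqVlt => /orP[/eqP dimS _|dimS dimN]; first by exists S.
have [N' [SN' N'N dimN']] := IHk dimS (ltnW dimN).
have [v vN vN'] : exists2 v, v \in N & v \notin N'.
  by apply/subvPn; apply: contraL dimN => /dimvS; rewrite dimN' -leqNgt.
exists (N' + <[v]>)%VS; split.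
- exact: subv_trans SN' (addvSl _ _).
- by rewrite subv_add N'N -memvE.
- by rewrite dim_add_line ?dimN'.
Qed.

Lemma isotropic_extend_dim S k : isotropic S -> (\dim S <= k <= n)%N ->
  exists N, [/\ isotropic N, (S <= N)%VS & \dim N = k].
Proof.
move=> isoS /andP[]; elim: k => [|k IHk].
  by rewrite leqn0 => /eqP dimS _; exists S.
rewrite leq_eqVlt => /orP[/eqP dimS _|dimS dimn]; first by exists S.
have [N [isoN SN dimN]] := IHk dimS (ltnW dimn).
rewrite -dimN in dimn; have [v [isoNv dimNv]] := isotropic_extend isoN dimn.
exists (N + <[v]>)%VS; split=> //; last by rewrite dimNv dimN.
exact: subv_trans SN (addvSl _ _).
Qed.

End SymplecticDimension.

(** * Pinchings, skeleton and mean state *)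

Section Pinching.
Variables (R : realType) (d n : nat).
Hypotheses (prime_d : prime d) (odd_d : odd d).
Local Notation V := (phase_space d n).
Local Notation W := (@weyl R d n).
Local Notation chi := (@chi R d).
Implicit Types (u v z : V) (N S : {vspace V}) (A : 'M[R[i]]_(hdim d n)).

(** Uniform on [N] and 0 elsewhere, so that a pinching is a [unitary_mix] indexed by the whole phase
    space. *)
Definition pinching_weight N u : R := (d%:R ^- \dim N) *+ (u \in N).

Lemma pinching_weight_ge0 N u : 0 <= pinching_weight N u.
Proof. by rewrite mulrn_wge0 // invr_ge0 exprn_ge0. Qed.

Lemma expd_neq0 (F : numFieldType) k : d%:R ^+ k != 0 :> F.
Proof. by rewrite expf_neq0 // pnatr_eq0 -lt0n prime_gt0. Qed.

Lemma sum_pinching_weight N : \sum_u pinching_weight N u = 1.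
Proof.
rewrite /pinching_weight; under eq_bigr do rewrite mulrb.
rewrite -big_mkcond sumr_const card_subspace // -[LHS]mulr_natr natrX.
by rewrite mulVf ?expd_neq0.
Qed.

Lemma pinchingE N A : pinching N A = unitary_mix A (pinching_weight N) W.
Proof.
rewrite /pinching /unitary_mix scaler_sumr big_mkcond; apply: eq_bigr => u _.
rewrite /pinching_weight; case: (u \in N); last by rewrite mulr0n rmorph0 scale0r.
by rewrite mulr1n fmorphV rmorphXn rmorph_nat.
Qed.

Lemma density_pinching N A : density A -> density (pinching N A).
Proof.
move=> [psdA trA]; rewrite pinchingE; split.
  by apply: psdmx_unitary_mix => // u; apply: pinching_weight_ge0.
rewrite trace_unitary_mix ?sum_pinching_weight // => u.
exact: weyl_unitary.
Qed.

Lemma entropy_pinching_ge N A : density A -> entropy A <= entropy (pinching N A).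
Proof.
move=> [psdA trA]; rewrite pinchingE; apply: entropy_unitary_mix_ge => //.
- by move=> u; apply: pinching_weight_ge0.
- exact: sum_pinching_weight.
- by move=> u; apply: weyl_unitary.
Qed.

(** The uniform weights on [d ^ \dim N] operators have Shannon entropy [\dim N] times [log2 d]. *)
Lemma entropy_pinching_le N A : density A ->
  entropy (pinching N A) <= entropy A + log2 d%:R *+ \dim N.
Proof.
move=> [psdA trA]; rewrite pinchingE.
have d_gt0 : 0 < d%:R :> R by rewrite ltr0n prime_gt0.
suff -> : log2 d%:R *+ \dim N =
    - \sum_u pinching_weight N u * log2 (pinching_weight N u).
  apply: entropy_unitary_mix_le => //.
  - by move=> u; apply: pinching_weight_ge0.
  - exact: sum_pinching_weight.
  - by move=> u; apply: weyl_unitary.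
have -> : \sum_u pinching_weight N u * log2 (pinching_weight N u) =
    \sum_u pinching_weight N u * log2 (d%:R ^- \dim N).
  apply: eq_bigr => u _; rewrite /pinching_weight.
  by case: (u \in N) => //; rewrite mulr0n !mul0r.
rewrite -mulr_suml sum_pinching_weight mul1r /log2.
by rewrite lnV ?posrE ?exprn_gt0 // lnXn // mulNr opprK mulrnAl.
Qed.

(** By cyclicity the conjugation passes to [W (- z)], where commuting it with [W u] costs only a
    phase. *)
Lemma charfun_conj A u z :
  charfun (W u *m A *m (W u)^t*) z = chi (sympl u z) * charfun A z.
Proof.
rewrite /charfun weyl_adj // -!mulmxA mxtrace_mulC -!mulmxA weyl_comm //.
rewrite -scalemxAr -scalemxAr.
have -> : W (- u) *m (W u *m W (- z)) = W (- z).
  by rewrite mulmxA -{2}(opprK u) weylNK // mul1mx.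
by rewrite symplNl -symplC mxtraceZ.
Qed.

Lemma charfun_pinching N A z :
  charfun (pinching N A) z = charfun A z *+ (z \in perp N).
Proof.
rewrite /charfun /pinching -scalemxAl mulmx_suml mxtraceZ raddf_sum /=.
under eq_bigr => u _ do
  rewrite -[\tr _]/(charfun (W u *m A *m (W u)^t*) z) charfun_conj.
rewrite -mulr_suml sum_chi_subspace // natrX mulrA mulrnAr mulVf ?expd_neq0 //.
by rewrite mulr_natl.
Qed.

(** [perp N'] lies in [perp N], so the indicator for [N'] absorbs the one for [N]. *)
Lemma pinching_pinching N N' A : (N <= N')%VS ->
  pinching N' (pinching N A) = pinching N' A.
Proof.
move=> NN'; apply: (charfun_inj prime_d) => z; rewrite !charfun_pinching.
have [zN'|] := boolP (z \in perp N'); last by rewrite !mulr0n.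
by rewrite (subvP (perpS prime_d NN')).
Qed.

(** The complement of a sum is the intersection of the complements. *)
Lemma pinching_add N N' A :
  pinching (N + N') A = pinching N' (pinching N A).
Proof.
apply: (charfun_inj prime_d) => z; rewrite !charfun_pinching -mulrnA mulnb.
congr (_ *+ nat_of_bool _); apply/(perpP prime_d)/andP => [zNN'|[]].
  split; apply/(perpP prime_d) => u uN; apply: zNN'.
    exact: subvP (addvSl _ _) _ uN.
  exact: subvP (addvSr _ _) _ uN.
move=> /(perpP prime_d) zN /(perpP prime_d) zN' w /memv_addP[u uN [v vN' ->]].
by rewrite symplDl zN // zN' // addr0.
Qed.

Lemma charfunE A z : charfun A z = \tr (A *m W (- z)).
Proof. by []. Qed.

End Pinching.

(** * Traces against a matrix satisfying two eigenvalue equations *)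

Section JointEigen.
Variables (F : numFieldType) (m : nat) (A B X : 'M[F]_m) (a b c : F).
Hypotheses (AX : A *m X = a *: X) (BX : B *m X = b *: X) (trX : \tr X = 1).

Lemma joint_eigen_trace : \tr (A *m B *m X) = a * b.
Proof.
by rewrite -mulmxA BX -scalemxAr AX scalerA mxtraceZ trX mulr1 mulrC.
Qed.

Lemma joint_eigen_norm (D : 'M[F]_m) : A *m B = c *: D ->
  `|c| = 1 -> `|a| = 1 -> `|b| = 1 -> `|\tr (X *m D)| = 1.
Proof.
move=> ABD c1 a1 b1; have := joint_eigen_trace.
rewrite ABD -scalemxAl mxtraceZ mxtrace_mulC => /(congr1 Num.norm).
by rewrite !normrM c1 a1 b1 !mul1r.
Qed.

(** Both orders of the product have the same nonzero trace [a * b] against [X], which leaves no room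
    for a commutation phase. *)
Lemma joint_eigen_comm (tr_BA : \tr (B *m A *m X) = b * a) :
  A *m B = c *: (B *m A) -> `|a| = 1 -> `|b| = 1 -> c = 1.
Proof.
move=> ABBA a1 b1; have := joint_eigen_trace.
rewrite ABBA -scalemxAl mxtraceZ tr_BA (mulrC b) -[RHS]mul1r => /mulIf; apply.
by rewrite -normr_eq0 normrM a1 b1 mulr1 oner_neq0.
Qed.

End JointEigen.

Lemma finite_argmin (R : realType) (T : finType) (P : T -> Prop) (f : T -> R) :
  (exists x, P x) -> exists x, P x /\ forall y, P y -> f x <= f y.
Proof.
move=> [x0 /asboolP Px0].
case: (arg_minP f (P := fun x => `[< P x >]) Px0) => x /asboolP Px minx.
by exists x; split=> // y /asboolP /minx.
Qed.

(** * Structure of the skeleton, the mean state and the attained minima *)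

Section Skeleton.
Variables (R : realType) (d n : nat) (sigma : 'M[R[i]]_(hdim d n)).
Hypotheses (prime_d : prime d) (odd_d : odd d) (dens : density sigma).
Local Notation V := (phase_space d n).
Local Notation W := (@weyl R d n).
Local Notation chi := (@chi R d).
Implicit Types (u v z : V) (N : {vspace V}).

Local Notation S := <<enum (skeleton sigma)>>%VS.

Lemma skeletonP z : reflect (`|charfun sigma z| = 1) (z \in skeleton sigma).
Proof. by rewrite inE; apply: eqP. Qed.

Lemma skeleton_eigen z : z \in skeleton sigma ->
  W (- z) *m sigma = charfun sigma z *: sigma.
Proof.
by move=> /skeletonP; rewrite charfunE; apply: unitary_eigen => //; apply: weyl_unitary.
Qed.

(** [W (- u)] and [W (- v)] act on [sigma] as scalars of modulus one, and so does their product,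
    which is [W (- (u + v))] up to a phase. *)
Lemma skeletonD : {in skeleton sigma &, forall u v, u + v \in skeleton sigma}.
Proof.
move=> u v uS vS; apply/skeletonP; rewrite charfunE.
have WW : W (- u) *m W (- v) =
    chi (2%:R^-1 * sympl (- u) (- v)) *: W (- (u + v)).
  by rewrite (weyl_mul R prime_d odd_d) opprD.
apply: (joint_eigen_norm (skeleton_eigen uS) (skeleton_eigen vS) dens.2 WW).
- exact: norm_chi.
- exact/skeletonP.
- exact/skeletonP.
Qed.

Lemma skeleton0 : 0 \in skeleton sigma.
Proof. by apply/skeletonP; rewrite charfunE oppr0 weyl0 // mulmx1 dens.2 normr1. Qed.

Lemma mem_skeleton z : (z \in S) = (z \in skeleton sigma).
Proof. by apply: mem_span_closed => //; [exact: skeleton0 | exact: skeletonD]. Qed.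

(** Both Weyl operators act on [sigma] as nonzero scalars, so their commutation phase is 1, and
    [chi] takes the value 1 only at 0. *)
Lemma isotropic_skeleton : isotropic S.
Proof.
move=> u v; rewrite !mem_skeleton => uS vS.
have [uE vE] := (skeleton_eigen uS, skeleton_eigen vS).
have comm := weyl_comm R prime_d odd_d (- u) (- v).
have := joint_eigen_comm uE vE dens.2 (joint_eigen_trace vE uE dens.2) comm.
rewrite symplNl symplNr opprK => chi1; apply/eqP.
rewrite -(chi_eq1 R prime_d); apply/eqP/chi1; exact/skeletonP.
Qed.

(** For [u] in the skeleton the eigenvalue and its conjugate cancel in [W u sigma (W u)^*], so every
    term of the average is [sigma]. *)
Lemma pinching_skeleton : pinching S sigma = sigma.
Proof.
rewrite /pinching (eq_bigr (fun=> sigma)) => [|u].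
  rewrite sumr_const card_subspace // -[sigma *+ _]scaler_nat scalerA natrX mulVf ?scale1r //.
  exact: expd_neq0.
rewrite -rpredN mem_skeleton => uS; have := skeleton_eigen uS; rewrite opprK => ->.
have -> : (W u)^t* = W (- u) by rewrite weyl_adj.
rewrite -scalemxAl; have := congr1 (fun X => X^t*) (skeleton_eigen uS).
rewrite opprK /= conjmx_mul (psdmx_hermitian dens.1) weyl_adj // => ->.
apply/matrixP => i j; rewrite !mxE rmorphM mulrA -normCK (skeletonP _ uS).
rewrite expr1n mul1r.
by have /matrixP/(_ i j) := psdmx_hermitian dens.1; rewrite conjmxE.
Qed.

(** The characteristic function of this pinching is supported on [perp (perp S) = S]; the pinching
    thus also witnesses that the description of the mean state is satisfiable. *)
Lemma mean_state_pinching : mean_state sigma = pinching (perp S) sigma.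
Proof.
have charM z : charfun (pinching (perp S) sigma) z =
    if z \in skeleton sigma then charfun sigma z else 0.
  rewrite charfun_pinching // (perpK R) // mem_skeleton.
  by case: (_ \in _).
apply: (charfun_inj prime_d) => z; rewrite charM /mean_state.
set P := (X in xget _ X).
have [] : P (xget 0 P); last by move=> _ ->.
apply: xgetPex; exists (pinching (perp S) sigma); split=> //.
exact: density_pinching.
Qed.

Lemma skeleton_subP N : {subset skeleton sigma <= N} <-> (S <= N)%VS.
Proof.
split=> [SN|/subvP SN u uS]; last by apply: SN; rewrite mem_skeleton.
by apply/subvP => u; rewrite mem_skeleton => /SN.
Qed.

(** Finitely many subspaces compete, and extending the skeleton provides at least one, so the
    minimum is attained and the default value of [least] does not occur. *)
Lemma min_pinching_entropyP k : (dim_skeleton sigma <= k <= n)%N ->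
  exists N, [/\ isotropic N, (S <= N)%VS, \dim N = k,
    min_pinching_entropy k sigma = entropy (pinching N sigma) &
    forall N', isotropic N' -> (S <= N')%VS -> \dim N' = k ->
      min_pinching_entropy k sigma <= entropy (pinching N' sigma)].
Proof.
(* The search runs over the finite type of subsets of the phase space; each subspace is the span of
   its own set of elements. *)
move=> rkn; pose span (E : {set V}) := <<enum E>>%VS.
have spanK N : span [set u | u \in N] = N.
  apply/vspaceP => u; rewrite mem_span_closed ?inE ?mem0v //.
  by move=> v w; rewrite !inE; apply: rpredD.
pose P (E : {set V}) := [/\ isotropic (span E), (S <= span E)%VS & \dim (span E) = k].
have [|E [[isoE SE dimE] minE]] :=
    @finite_argmin _ _ P (fun E => entropy (pinching (span E) sigma)).
  have [N [isoN SN dimN]] := isotropic_extend_dim R prime_d isotropic_skeleton rkn.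
  by exists [set u | u \in N]; rewrite /P spanK.
rewrite /min_pinching_entropy /least; set Q := (X in xget _ X).
have [[N [isoN /skeleton_subP SN dimN ->]] lbN] : Q (xget 0 Q).
  apply: xgetPex; exists (entropy (pinching (span E) sigma)); split.
    by exists (span E); split=> //; apply/skeleton_subP.
  move=> _ [N [isoN /skeleton_subP SN dimN ->]].
  by rewrite -(spanK N); apply: minE; rewrite /P spanK.
exists N; split; [exact: isoN | exact: SN | exact: dimN | reflexivity |].
move=> N' isoN' SN' dimN'; apply: lbN; exists N'.
by split; [exact: isoN' | exact/skeleton_subP | exact: dimN' | reflexivity].
Qed.

End Skeleton.

(** * The chain of minimal pinching entropies *)

Theorem corollary10 (R : realType) (d n : nat) (sigma : 'M[R[i]]_(hdim d n)) :
  prime d -> odd d -> (1 <= n)%N -> density sigma ->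
  let r := dim_skeleton sigma in
  let s := fun k : nat => min_pinching_entropy k sigma in
  [/\ entropy sigma = s r,
      forall k : nat, (r <= k < n)%N -> s k <= s k.+1,
      s n <= entropy (mean_state sigma)
    & forall k : nat, (r <= k < n)%N -> 0 <= s k.+1 - s k <= log2 d%:R].
Proof.
move=> prime_d odd_d _ dens r s.
pose S := <<enum (skeleton sigma)>>%VS.
have isoS : isotropic S := isotropic_skeleton prime_d odd_d dens.
have r_le_n : (r <= n)%N := isotropic_dim R prime_d isoS.
have minP := min_pinching_entropyP prime_d odd_d dens.
have mono k : (r <= k < n)%N -> s k <= s k.+1.
  move=> /andP[rk kn].
  have [|N' [isoN' SN' dimN' sE _]] := minP k.+1; first by rewrite kn ltnW.
  have [|_ [_ _ _ _ s_le]] := minP k; first by rewrite rk ltnW.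
  (* A minimizer [N'] of dimension [k.+1] is shrunk to a competitor [N] of dimension [k]; pinching
     further from [N] to [N'] can only raise the entropy. *)
  have [|N [SN NN' dimN]] := intermediate_subspace (k := k) SN'.
    by rewrite dimN' leqnSn andbT.
  have isoN : isotropic N.
    by move=> u v uN vN; apply: isoN'; apply: (subvP NN').
  apply: (le_trans (s_le N isoN SN dimN)).
  rewrite /s sE -(pinching_pinching prime_d odd_d sigma NN').
  exact/entropy_pinching_ge/density_pinching.
split=> //.
- have [|N [_ SN dimN sE _]] := minP r; first by rewrite leqnn.
  (* In dimension [r] the skeleton is the only competitor. *)
  rewrite /s sE; have -> : N = S.
    by apply/eqP; rewrite eq_sym eqEdim SN dimN leqnn.
  by congr entropy; apply/esym/pinching_skeleton.
- have [|N [isoN SN dimN sE _]] := minP n; first by rewrite r_le_n leqnn.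
  rewrite /s sE (mean_state_pinching prime_d odd_d dens).
  (* Isotropy gives that [N] lies in [perp N], hence in [perp S], so the mean state is a further
     pinching of the minimizer. *)
  have NS : (N <= perp S)%VS.
    exact: subv_trans ((isotropicE prime_d N).1 isoN) (perpS prime_d SN).
  rewrite -(pinching_pinching prime_d odd_d sigma NS).
  exact/entropy_pinching_ge/density_pinching.
- move=> k /[dup] /mono s_mono /andP[rk kn]; rewrite subr_ge0 s_mono /=.
  have [|N [isoN SN dimN sE _]] := minP k; first by rewrite rk ltnW.
  have [|_ [_ _ _ _ s_le]] := minP k.+1; first by rewrite kn ltnW.
  (* A minimizer of dimension [k] is extended by a line; the extra pinching by that line costs at
     most [log2 d]. *)
  rewrite -dimN in kn; have [v [isoNv dimNv]] := isotropic_extend R prime_d isoN kn.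
  rewrite lerBlDl /s sE.
  apply: (le_trans (s_le _ isoNv (subv_trans SN (addvSl _ _)) _)).
    by rewrite dimNv dimN.
  rewrite (pinching_add prime_d odd_d).
  apply: le_trans (entropy_pinching_le prime_d odd_d _ _) _.
    exact: density_pinching.
  rewrite lerD2l dim_vline; case: (v != 0); first by rewrite mulr1n.
  by rewrite mulr0n divr_ge0 ?ln_ge0 ?ler1n ?prime_gt0.
Qed.
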